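(* Let $(A,\cdot,\{~,~,~\},\{\!\{~,~,~\}\!\})$ be an associative-Yamaguti algebra. Then $(A,[~,~],\llbracket~,~,~\rrbracket)$ is a Lie-Yamaguti algebra, where for $a,b,c\in A$, $$[a,b]=a\cdot b-b\cdot a,\qquad \llbracket a,b,c\rrbracket=\{a,b,c\}-\{b,a,c\}-\{\!\{c,a,b\}\!\}+\{\!\{c,b,a\}\!\}.$$ Moreover, if $A$ and $A'$ are two associative-Yamaguti algebras and $\varphi:A\to A'$ is a homomorphism of associative-Yamaguti algebras, then $\varphi$ is also a homomorphism between the corresponding Lie-Yamaguti algebras.
   Context: All vector spaces, linear maps, tensor and wedge products are over a field $\mathbf{k}$ of characteristic $0$. An associative-Yamaguti algebra is a quadruple $(A,\cdot,\{~,~,~\},\{\!\{~,~,~\}\!\})$ consisting of a vector space $A$ with linear operations $\cdot:A\otimes A\to A$ and $\{~,~,~\},\{\!\{~,~,~\}\!\}:A\otimes A\otimes A\to A$ such that for all $a,b,c,d,e\in A$: (AY1) $(a\cdot b)\cdot c-a\cdot(b\cdot c)+\{a,b,c\}-\{\!\{a,b,c\}\!\}=0$; (AY2) $\{a\cdot b,c,d\}=\{a,b\cdot c,d\}$; (AY3) $\{a,b,c\cdot d\}=\{a,b,c\}\cdot d$; (AY4) $\{\!\{a\cdot b,c,d\}\!\}=a\cdot\{\!\{b,c,d\}\!\}$; (AY5) $\{\!\{a,b\cdot c,d\}\!\}=\{\!\{a,b,c\cdot d\}\!\}$; (AY6) $a\cdot\{b,c,d\}=\{\!\{a,b,c\}\!\}\cdot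 d$; (AY7) $\{\{a,b,c\},d,e\}=\{a,\{\!\{b,c,d\}\!\},e\}=\{a,b,\{c,d,e\}\}$; (AY8) $\{a,\{b,c,d\},e\}=\{\{\!\{a,b,c\}\!\},d,e\}$; (AY9) $\{\!\{\{\!\{a,b,c\}\!\},d,e\}\!\}=\{\!\{a,\{b,c,d\},e\}\!\}=\{\!\{a,b,\{\!\{c,d,e\}\!\}\}\!\}$; (AY10) $\{\!\{a,\{\!\{b,c,d\}\!\},e\}\!\}=\{\!\{a,b,\{c,d,e\}\}\!\}$; (AY11) $\{a,b,\{\!\{c,d,e\}\!\}\}=\{\!\{\{a,b,c\},d,e\}\!\}$. A homomorphism of associative-Yamaguti algebras is a linear map preserving the three operations. A Lie-Yamaguti algebra is a triple $(\mathfrak{g},[~,~],\llbracket~,~,~\rrbracket)$ of a vector space $\mathfrak{g}$ with linear maps $[~,~]:\wedge^2\mathfrak{g}\to\mathfrak{g}$ and $\llbracket~,~,~\rrbracket:\wedge^2\mathfrak{g}\otimes\mathfrak{g}\to\mathfrak{g}$ such that for all $x,y,z,w,t\in\mathfrak{g}$: (LY1) $[[x,y],z]+[[y,z],x]+[[z,x],y]+\llbracket x,y,z\rrbracket+\llbracket y,z,x\rrbracket+\llbracket z,x,y\rrbracket=0$; (LY2) $\llbracket[x,y],z,w\rrbracket+\llbracket[y,z],x,w\rrbracket+\llbracket[z,x],y,w\rrbracket=0$; (LY3) $\llbracket x,y,[z,w]\rrbracket=[\llbracket x,y,z\rrbracket,w]+[z,\llbracket x,y,w\rrbracket]$; (LY4)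 $\llbracket x,y,\llbracket z,w,t\rrbracket\rrbracket=\llbracket\llbracket x,y,z\rrbracket,w,t\rrbracket+\llbracket z,\llbracket x,y,w\rrbracket,t\rrbracket+\llbracket z,w,\llbracket x,y,t\rrbracket\rrbracket$. A homomorphism of Lie-Yamaguti algebras is a linear map preserving both brackets. *)

(* Defs.v *)
From mathcomp Require Import all_boot all_algebra.

Set Implicit Arguments.
Unset Strict Implicit.
Unset Printing Implicit Defensive.

Import GRing.Theory.
Local Open Scope ring_scope.

(* Linear maps out of A (x) A, A (x) A (x) A, /\^2 A and /\^2 A (x) A are
   represented by curried functions: bilinear, trilinear, and alternating
   (in the first two arguments) bilinear and trilinear maps respectively. *)

Section Multilinear.
Variables (k : fieldType) (A : lmodType k).

Definition bilinear_op (f : A -> A -> A) : Prop :=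
  (forall b, linear (fun a => f a b)) /\ (forall a, linear (fun b => f a b)).

Definition trilinear_op (f : A -> A -> A -> A) : Prop :=
  [/\ forall b c, linear (fun a => f a b c),
      forall a c, linear (fun b => f a b c)
    & forall a b, linear (fun c => f a b c)].

End Multilinear.

Section AssociativeYamaguti.
Variables (k : fieldType) (A : lmodType k).

(* [t a b c] is {a, b, c} and [d a b c] is {{a, b, c}}. *)
Record is_AY_algebra (mul : A -> A -> A) (t d : A -> A -> A -> A) : Prop := {
  AY_mul_bilinear : bilinear_op mul;
  AY_t_trilinear : trilinear_op t;
  AY_d_trilinear : trilinear_op d;
  AY1 : forall x y z : A,
    mul (mul x y) z - mul x (mul y z) + t x y z - d x y z = 0;
  AY2 : forall x y z w : A, t (mul x y) z w = t x (mul y z) w;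
  AY3 : forall x y z w : A, t x y (mul z w) = mul (t x y z) w;
  AY4 : forall x y z w : A, d (mul x y) z w = mul x (d y z w);
  AY5 : forall x y z w : A, d x (mul y z) w = d x y (mul z w);
  AY6 : forall x y z w : A, mul x (t y z w) = mul (d x y z) w;
  AY7 : forall x y z w u : A,
    t (t x y z) w u = t x (d y z w) u /\ t x (d y z w) u = t x y (t z w u);
  AY8 : forall x y z w u : A, t x (t y z w) u = t (d x y z) w u;
  AY9 : forall x y z w u : A,
    d (d x y z) w u = d x (t y z w) u /\ d x (t y z w) u = d x y (d z w u);
  AY10 : forall x y z w u : A, d x (d y z w) u = d x y (t z w u);
  AY11 : forall x y z w u : A, t x y (d z w u) = d (t x y z) w u
}.

End AssociativeYamaguti.

Record is_AY_hom (k : fieldType) (A A' : lmodType k)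
    (mul : A -> A -> A) (t d : A -> A -> A -> A)
    (mul' : A' -> A' -> A') (t' d' : A' -> A' -> A' -> A')
    (phi : A -> A') : Prop := {
  AY_hom_linear : linear phi;
  AY_hom_mul : forall a b : A, phi (mul a b) = mul' (phi a) (phi b);
  AY_hom_t : forall a b c : A, phi (t a b c) = t' (phi a) (phi b) (phi c);
  AY_hom_d : forall a b c : A, phi (d a b c) = d' (phi a) (phi b) (phi c)
}.

Section LieYamaguti.
Variables (k : fieldType) (g : lmodType k).

(* [br x y] is [x, y] and [tb x y z] is [[x, y, z]]. *)
Record is_LY_algebra (br : g -> g -> g) (tb : g -> g -> g -> g) : Prop := {
  LY_br_bilinear : bilinear_op br;
  LY_br_alternating : forall x : g, br x x = 0;
  LY_tb_trilinear : trilinear_op tb;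
  LY_tb_alternating : forall x y : g, tb x x y = 0;
  LY1 : forall x y z : g,
    br (br x y) z + br (br y z) x + br (br z x) y
      + tb x y z + tb y z x + tb z x y = 0;
  LY2 : forall x y z w : g,
    tb (br x y) z w + tb (br y z) x w + tb (br z x) y w = 0;
  LY3 : forall x y z w : g,
    tb x y (br z w) = br (tb x y z) w + br z (tb x y w);
  LY4 : forall x y z w u : g,
    tb x y (tb z w u)
      = tb (tb x y z) w u + tb z (tb x y w) u + tb z w (tb x y u)
}.

End LieYamaguti.

Record is_LY_hom (k : fieldType) (g g' : lmodType k)
    (br : g -> g -> g) (tb : g -> g -> g -> g)
    (br' : g' -> g' -> g') (tb' : g' -> g' -> g' -> g')
    (phi : g -> g') : Prop := {
  LY_hom_linear : linear phi;
  LY_hom_br : forall x y : g, phi (br x y) = br' (phi x) (phi y);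
  LY_hom_tb : forall x y z : g, phi (tb x y z) = tb' (phi x) (phi y) (phi z)
}.

Section Induced.
Variables (k : fieldType) (A : lmodType k).

Definition AY_bracket (mul : A -> A -> A) (a b : A) : A := mul a b - mul b a.

Definition AY_tribracket (t d : A -> A -> A -> A) (a b c : A) : A :=
  t a b c - t b a c - d c a b + d c b a.

End Induced.

(* Main.v *)
Require Import Defs.
From mathcomp Require Import all_boot all_algebra.

Set Implicit Arguments.
Unset Strict Implicit.
Unset Printing Implicit Defensive.

Import GRing.Theory.
Local Open Scope ring_scope.

(** Put [E a b c = {a,b,c} - {{c,a,b}}], so that [[a,b,c]] = E a b c - E b a c.
    Each map [E x y] is a derivation of the product and of both ternary
    operations: by (AY3)-(AY11) the Leibniz sum telescopes. Hence [[x,y,-]] is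
    a derivation of everything built from these operations, which gives (LY3)
    and (LY4). The left-hand sides of (LY1) and (LY2) are cyclic sums of
    [F x y z - F y x z - (F z x y - F z y x)], which vanish for every [F]. Here
    [F x y z] is [(x y) z + {x,y,z} = x (y z) + {{x,y,z}}] by (AY1) for (LY1),
    and [{x y,z,w} - {{w,x y,z}} = {x,y z,w} - {{w,x,y z}}] by (AY2) and (AY5)
    for (LY2). *)

Section ZmodIdentities.
Variable V : zmodType.
Implicit Types a b c e : V.

Lemma subrDD a b c e : a + b - (c + e) = (a - c) + (b - e).
Proof. by rewrite opprD addrACA. Qed.

Lemma subrD3 a1 b1 c1 a2 b2 c2 :
  a1 + b1 + c1 - (a2 + b2 + c2) = (a1 - a2) + (b1 - b2) + (c1 - c2).
Proof. by rewrite !subrDD. Qed.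

Lemma subrACA a b c e : a - b - (c - e) = a - c - (b - e).
Proof. by rewrite !opprB [e - c]addrC [e - b]addrC addrACA. Qed.

(** Pair each value of [F] with its value at the reversed triple, and let [S_m] be the sum of the
    pair with middle argument [m]. The three summands are [S_y - S_x], [S_z - S_y] and
    [S_x - S_z]. *)
Lemma cyclic_sum_eq0 (X : Type) (F : X -> X -> X -> V) x y z :
  (F x y z - F y x z - (F z x y - F z y x))
  + (F y z x - F z y x - (F x y z - F x z y))
  + (F z x y - F x z y - (F y z x - F y x z)) = 0.
Proof.
set p := F x y z; set q := F y x z; set r := F z x y.
set s := F z y x; set u := F y z x; set v := F x z y.
have swap a b c e : a - b - (c - e) = (a + e) - (b + c).
  by rewrite opprB opprD addrACA.
rewrite !swap [s + p]addrC [v + u]addrC [r + q]addrC addrAC.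
have tele a b c : a - b + (b - c) + (c - a) = 0 by rewrite !addrA !subrK subrr.
exact: tele.
Qed.

End ZmodIdentities.

Section LinearMaps.
Variables (k : fieldType) (U V : lmodType k).
Implicit Types f g : U -> V.

Lemma linear_subr f g : linear f -> linear g -> linear (fun x => f x - g x).
Proof. by move=> fL gL a x y; rewrite fL gL opprD addrACA -scalerBr. Qed.

End LinearMaps.

Section Derivations.
Variables (k : fieldType) (A : lmodType k).
Implicit Types (mul : A -> A -> A) (f t d : A -> A -> A -> A) (D : A -> A).

Definition derivation2 mul D :=
  forall x y, D (mul x y) = mul (D x) y + mul x (D y).

Definition derivation3 f D :=
  forall x y z, D (f x y z) = f (D x) y z + f x (D y) z + f x y (D z).

(** The product is fixed and the derivations vary, so the difference passes through each slot by
    bilinearity. *)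
Lemma derivation2_subr mul D1 D2 : bilinear_op mul ->
  derivation2 mul D1 -> derivation2 mul D2 ->
  derivation2 mul (fun x => D1 x - D2 x).
Proof.
move=> [mulL mulR] D1d D2d x y.
rewrite D1d D2d (zmod_morphism_linear (mulL y)) (zmod_morphism_linear (mulR x)).
exact: subrDD.
Qed.

Lemma derivation3_subr f D1 D2 : trilinear_op f ->
  derivation3 f D1 -> derivation3 f D2 ->
  derivation3 f (fun x => D1 x - D2 x).
Proof.
move=> [f1 f2 f3] D1d D2d x y z; rewrite D1d D2d subrD3.
rewrite (zmod_morphism_linear (f1 y z)) (zmod_morphism_linear (f2 x z)).
by rewrite (zmod_morphism_linear (f3 x y)).
Qed.

Lemma derivation2_bracket mul D : {morph D : x y / x - y} ->
  derivation2 mul D -> derivation2 (AY_bracket mul) D.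
Proof.
move=> DB Dd x y.
by rewrite /AY_bracket DB !Dd [mul (D y) x + _]addrC opprD addrACA.
Qed.

(** Here [D] is fixed and the operations vary, so additivity of [D] replaces multilinearity. *)
Lemma derivation3_sub f g D : {morph D : x y / x - y} ->
  derivation3 f D -> derivation3 g D ->
  derivation3 (fun x y z => f x y z - g x y z) D.
Proof. by move=> DB fD gD x y z; rewrite DB fD gD subrD3. Qed.

Lemma derivation3_swap f D :
  derivation3 f D -> derivation3 (fun x y z => f y x z) D.
Proof. by move=> fD x y z; rewrite fD [f (D y) x z + _]addrC. Qed.

Lemma derivation3_rot f D :
  derivation3 f D -> derivation3 (fun x y z => f z x y) D.
Proof. by move=> fD x y z; rewrite fD [RHS]addrC addrA. Qed.

End Derivations.

Section AYtoLY.
Variables (k : fieldType) (A : lmodType k).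
Variables (mul : A -> A -> A) (t d : A -> A -> A -> A).
Hypothesis AY : is_AY_algebra mul t d.

Let E x y z := t x y z - d z x y.

Let tribracketE x y z : AY_tribracket t d x y z = E x y z - E y x z.
Proof. by rewrite /AY_tribracket /E subrACA opprD opprK addrA. Qed.

Let E_trilinear : trilinear_op E.
Proof.
case: (AY_t_trilinear AY) (AY_d_trilinear AY) => t1 t2 t3 [d1 d2 d3].
(* The arguments of [d] are rotated in [E], so slots 1, 2, 3 of [E] are slots 2, 3, 1 of [d]. *)
split=> x y; apply: linear_subr.
- exact: t1.
- exact: d2.
- exact: t2.
- exact: d3.
- exact: t3.
- exact: d1.
Qed.

Let E_derivation2_mul x y : derivation2 mul (E x y).
Proof.
move=> z w; have [mulL mulR] := AY_mul_bilinear AY; rewrite /E.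
rewrite (zmod_morphism_linear (mulL w)) (zmod_morphism_linear (mulR z)).
(* (AY3) and (AY4) match the outer terms; the two middle ones cancel by (AY6). *)
by rewrite (AY3 AY) (AY4 AY) (AY6 AY) addrA subrK.
Qed.

Let E_derivation3_t x y : derivation3 t (E x y).
Proof.
move=> z w u; have [t1 t2 t3] := AY_t_trilinear AY; rewrite /E.
rewrite (zmod_morphism_linear (t1 w u)) (zmod_morphism_linear (t2 z u)).
rewrite (zmod_morphism_linear (t3 z w)).
(* Of the six terms on the right, the 2nd and 3rd cancel by (AY8), the 4th and 5th by (AY7); the 1st
   and 6th give the left side by (AY7) and (AY11). *)
have [txyz txyz'] := AY7 AY x y z w u; have [_ tzwx] := AY7 AY z w x y u.
by rewrite txyz txyz' (AY8 AY) tzwx (AY11 AY) !addrA !subrK.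
Qed.

Let E_derivation3_d x y : derivation3 d (E x y).
Proof.
move=> z w u; have [d1 d2 d3] := AY_d_trilinear AY; rewrite /E.
rewrite (zmod_morphism_linear (d1 w u)) (zmod_morphism_linear (d2 z u)).
rewrite (zmod_morphism_linear (d3 z w)).
(* Same pattern: (AY9) and (AY10) cancel the inner pairs, (AY11) and (AY9) match the ends. *)
have [dzxy _] := AY9 AY z x y w u; have [dzwu dzwu'] := AY9 AY z w u x y.
by rewrite (AY11 AY) dzxy (AY10 AY) -dzwu' -dzwu !addrA !subrK.
Qed.

Let tb_morphB x y : {morph AY_tribracket t d x y : z w / z - w}.
Proof.
move=> z w; have [_ _ E3] := E_trilinear; rewrite !tribracketE.
rewrite (zmod_morphism_linear (E3 x y)) (zmod_morphism_linear (E3 y x)).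
exact: subrACA.
Qed.

Let tb_derivation2 x y : derivation2 mul (AY_tribracket t d x y).
Proof.
have Dd := derivation2_subr (AY_mul_bilinear AY) (E_derivation2_mul x y)
  (E_derivation2_mul y x).
by move=> z w; rewrite !tribracketE Dd.
Qed.

Let tb_derivation3 f : trilinear_op f -> (forall x y, derivation3 f (E x y)) ->
  forall x y, derivation3 f (AY_tribracket t d x y).
Proof.
move=> f3 Ef x y z w u.
by rewrite !tribracketE (derivation3_subr f3 (Ef x y) (Ef y x)).
Qed.

Lemma AY_LY_algebra : is_LY_algebra (AY_bracket mul) (AY_tribracket t d).
Proof.
have [mulL mulR] := AY_mul_bilinear AY; have [E1 E2 E3] := E_trilinear.
split.
- split=> a; apply: linear_subr.
  + exact: mulL.
  + exact: mulR.
  + exact: mulR.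
  + exact: mulL.
- by move=> x; exact: subrr.
- split=> a b x u v; rewrite !tribracketE; move: x u v; apply: linear_subr.
  + exact: E1.
  + exact: E2.
  + exact: E2.
  + exact: E1.
  + exact: E3.
  + exact: E3.
- by move=> x y; rewrite tribracketE subrr.
- move=> x y z.
  pose F x y z := mul (mul x y) z + t x y z.
  have FE a b c : F a b c = mul a (mul b c) + d a b c.
    apply/eqP; rewrite -subr_eq0 opprD addrACA addrA; apply/eqP.
    exact: (AY1 AY a b c).
  have brE a b c :
      AY_bracket mul (AY_bracket mul a b) c + AY_tribracket t d a b c
      = F a b c - F b a c - (F c a b - F c b a).
    rewrite [F c a b]FE [F c b a]FE /F /AY_bracket tribracketE /E.
    rewrite (zmod_morphism_linear (mulL c)) (zmod_morphism_linear (mulR c)).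
    by rewrite [X in _ + X]subrACA -!subrDD.
  apply: etrans (cyclic_sum_eq0 F x y z); rewrite -!brE.
  by rewrite [X in _ = X + _]addrACA [RHS]addrACA !addrA.
- move=> x y z w.
  pose F x y z := t (mul x y) z w - d w (mul x y) z.
  have brE a b c : AY_tribracket t d (AY_bracket mul a b) c w
      = F a b c - F b a c - (F c a b - F c b a).
    rewrite tribracketE /AY_bracket (zmod_morphism_linear (E1 c w)).
    by rewrite (zmod_morphism_linear (E2 c w)) /F /E !(AY2 AY c) !(AY5 AY w c).
  by rewrite !brE cyclic_sum_eq0.
- by move=> x y; apply: derivation2_bracket.
(* Only the differentiated brackets are expanded into [E]; [AY_tribracket t d x y] stays whole as
   the derivation. *)
- move=> x y z w u; rewrite !(tribracketE z).
  rewrite !(tribracketE (AY_tribracket _ _ _ _ _)).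
  have ED : derivation3 E (AY_tribracket t d x y).
    apply: derivation3_sub => //; last apply: derivation3_rot.
      exact: tb_derivation3 (AY_t_trilinear AY) E_derivation3_t x y.
    exact: tb_derivation3 (AY_d_trilinear AY) E_derivation3_d x y.
  exact: (derivation3_sub (tb_morphB x y) ED (derivation3_swap ED)).
Qed.

End AYtoLY.

Theorem theorem3p11 (k : fieldType) (char0 : [pchar k] =i pred0) :
  (forall (A : lmodType k) (mul : A -> A -> A) (t d : A -> A -> A -> A),
      is_AY_algebra mul t d ->
      is_LY_algebra (AY_bracket mul) (AY_tribracket t d))
  /\
  (forall (A A' : lmodType k)
          (mul : A -> A -> A) (t d : A -> A -> A -> A)
          (mul' : A' -> A' -> A') (t' d' : A' -> A' -> A' -> A')
          (phi : A -> A'),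
      is_AY_algebra mul t d ->
      is_AY_algebra mul' t' d' ->
      is_AY_hom mul t d mul' t' d' phi ->
      is_LY_hom (AY_bracket mul) (AY_tribracket t d)
                (AY_bracket mul') (AY_tribracket t' d') phi).
Proof.
split=> [A mul t d|A A' mul t d mul' t' d' phi _ _ [phiL phiM phit phid]].
  exact: AY_LY_algebra.
have phiB := zmod_morphism_linear phiL.
(* The last term of [AY_tribracket] is added, so sums are needed besides differences. *)
have phiD x y : phi (x + y) = phi x + phi y.
  by rewrite -[x]scale1r phiL !scale1r.
split=> // [x y|x y z]; rewrite /AY_bracket /AY_tribracket.
  by rewrite phiB !phiM.
by rewrite phiD !phiB !phit !phid.
Qed.
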